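(* The random variables $X_{i,i}^{(n)}$, $i\in\mathbb{N}$, are asymptotically independent in the following sense: for any $k\in\mathbb{N}$, any subset $I\subseteq\mathbb{N}$ of size $k$, and any $(x_i)_{i\in I}\in\{0,1\}^I$ we have $$\mathbb{P}(X_{i,i}^{(n)}=x_i,\ i\in I)-\prod_{i\in I}\mathbb{P}(X_{i,i}^{(n)}=x_i)=O\Big(\frac1n\Big)\qquad(n\to\infty),$$ with implied constant depending on $I$ only via $k$ (so it may depend on $p$ and $k$, but not otherwise on $I$).
   Context: Let $0<p<1$, $q=1-p$. $Z_1,Z_2,\ldots,Z_n$ are i.i.d. geometric random variables, $\mathbb{P}(Z_k=i)=P_i:=p\,q^{i-1}$ for $i\ge1$. $X_{i,i}^{(n)}$ is the indicator of the event that the pair $(i,i)$ appears at least once as a consecutive pair, i.e. that $Z_k=Z_{k+1}=i$ for some $1\le k\le n-1$. *)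

(* Defs.v *)
From mathcomp Require Export all_boot all_order all_algebra finmap.
From mathcomp Require Export all_classical all_reals all_analysis.

Set Implicit Arguments.
Unset Strict Implicit.
Unset Printing Implicit Defensive.

Export Order.TTheory GRing.Theory Num.Theory.

Local Open Scope classical_set_scope.
Local Open Scope ring_scope.

(* Probabilities are finite, so [fine] loses no information. *)
Definition prob {d : measure_display} {T : measurableType d} {R : realType}
  (P : probability T R) (A : set T) : R := fine (P A).

Definition mutually_independent {d d' : measure_display}
  {T : measurableType d} {S : measurableType d'} {R : realType}
  (P : probability T R) {K : finType} (Z : K -> {RV P >-> S}) : Prop :=
  forall (J : {set K}) (B : K -> set S),
    (forall k, k \in J -> measurable (B k)) ->
    prob P [set w | forall k, k \in J -> B k (Z k w)] =
    \prod_(k in J) prob P (Z k @^-1` B k).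

(* Supported on {1, 2, ...}: the masses below add up to 1, so P (Y = 0) = 0. *)
Definition geometric_rv {d : measure_display} {T : measurableType d}
  {R : realType} (P : probability T R) (p : R) (Y : {RV P >-> nat}) : Prop :=
  forall i : nat, (1 <= i)%N ->
    prob P (Y @^-1` [set i]) = p * (1 - p) ^+ i.-1.

(* [Z k] with [k : 'I_n] stands for Z_(k+1). *)
Definition iid_geometric {d : measure_display} {T : measurableType d}
  {R : realType} (P : probability T R) (p : R) (n : nat)
  (Z : 'I_n -> {RV P >-> nat}) : Prop :=
  mutually_independent Z /\ forall k, geometric_rv p (Z k).

Definition pair_appears {T : Type} (n : nat) (Z : 'I_n -> T -> nat) (i : nat) :
  set T :=
  [set w | exists k l : 'I_n, [/\ l = k.+1 :> nat, Z k w = i & Z l w = i]].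

Definition pair_indicator {T : Type} {R : realType} (n : nat)
  (Z : 'I_n -> T -> nat) (i : nat) : T -> R := \1_(pair_appears Z i).

(* Main.v *)
Require Import Defs.
From mathcomp Require Import ring lra zify.

Set Implicit Arguments.
Unset Strict Implicit.
Unset Printing Implicit Defensive.

Local Open Scope classical_set_scope.
Local Open Scope ring_scope.

(** Let [a n] be the probability that a word of [n] letters contains no pair
    [ii] with [i] in [J], and [b i n] the loss in this probability when the
    word is preceded by a letter [i]. Then [a] and [b i] satisfy a linear
    recurrence, and [a (n + 2) <= (1 - \sum_(i in J) P i ^ 2) * a n].
    For [i] outside [J], the products of the solutions for [J] and for [{i}]
    satisfy the recurrence for [i |: J] up to an error. Let the product system
    handle the first [m] letters and the joint system the others: passing from
    [m] to [m + 1] costs at most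
    [O(\sum_j x y exp (- n (x + y) / 2))], where [x = P i ^ 2], [y = P j ^ 2].
    Summing over [m < n] and using [t exp (- t / 2) <= 2] for [t = n x] and
    [t = n y] gives [O(1 / n)], uniformly in the [P i]. Induction on [J]
    decouples all avoidance events, and inclusion-exclusion handles the events
    that prescribe some pairs to appear. *)

Definition avoidance_system (R : realType) (K : finType) (P : K -> R)
    (J : {set K}) (a : nat -> R) (b : K -> nat -> R) : Prop :=
  [/\ a 0%N = 1 /\ (forall i, b i 0%N = 0),
      forall n, 0 <= a n,
      forall n, a n.+1 = a n - \sum_(i in J) P i * b i n,
      forall i n, i \in J -> b i n.+1 = P i * (a n - b i n) &
      forall i n, i \in J -> 0 <= b i n <= a n].

(** * Monotonicity, exponential decay and duality for the recurrence *)

Section avoidance_systems.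
Context (R : realType) (K : finType) (P : K -> R).
Context (P01 : forall i, 0 <= P i <= 1).


Lemma avoidance_antitone J a b n : avoidance_system P J a b -> a n.+1 <= a n.
Proof.
move=> [_ _ aS _ ab]; rewrite aS gerBl sumr_ge0// => i iJ.
have /andP[? ?] := P01 i; have /andP[? ?] := ab i n iJ; exact: mulr_ge0.
Qed.

Lemma avoidance_le_pred J a b n : avoidance_system P J a b -> a n <= a n.-1.
Proof. by move=> H; case: n => //= n; exact: avoidance_antitone H. Qed.

Lemma avoidance_le1 J a b n : avoidance_system P J a b -> a n <= 1.
Proof.
move=> H; elim: n => [|n IH]; first by case: H => -[->].
exact: le_trans (avoidance_antitone _ H) IH.
Qed.

Lemma avoidance_b_le J a b i n : avoidance_system P J a b -> i \in J ->
  b i n <= P i * a n.-1.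
Proof.
move=> [[a0 b0] _ aS bS ab] iJ; have /andP[Pi0 _] := P01 i.
case: n => [|n]; first by rewrite b0 a0 mulr1.
by rewrite bS//= ler_wpM2l// gerBl; have /andP[] := ab i n iJ.
Qed.

(* The last two letters form a forbidden pair with probability
   [\sum_(i in J) P i ^+ 2]. *)
Lemma avoidance_decay2 J a b n : avoidance_system P J a b ->
  a n.+2 <= (1 - \sum_(i in J) P i ^+ 2) * a n.
Proof.
move=> [[a0 b0] _ aS bS ab].
rewrite aS (eq_bigr (fun i => P i ^+ 2 * a n - P i ^+ 2 * b i n)); last first.
  by move=> i iJ; rewrite bS//; ring.
rewrite big_split/= sumrN -mulr_suml aS mulrBl mul1r.
suff : \sum_(i in J) P i ^+ 2 * b i n <= \sum_(i in J) P i * b i n by lra.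
apply: ler_sum => i iJ; have /andP[? ?] := ab i n iJ; have /andP[? ?] := P01 i.
by apply: ler_wpM2r => //; rewrite expr2 ler_piMr.
Qed.

(** Each pair of steps gains a factor [1 - c <= expR (- c)], hence the rate [c / 2] per step. The
    induction advances by two, so it has two base cases; the shift in [1 - n%:R] makes the bound at
    least 1 in both of them. *)
Lemma avoidance_decay J a b c n : avoidance_system P J a b ->
  0 <= c <= \sum_(i in J) P i ^+ 2 ->
  a n <= expR ((1 - n%:R) * c / 2).
Proof.
move=> H /andP[c0 cS]; have [_ age0 _ _ _] := H.
have [n2] := ubnP n; elim: n2 n => // N IH [|[|n]] ltN.
- rewrite subr0 mul1r; have [[-> _] _ _ _ _] := H.
  by apply: le_trans (expR_ge1Dx _); lra.
- by rewrite subrr !mul0r expR0; exact: avoidance_le1 H.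
- apply: le_trans (avoidance_decay2 n H) _.
  have -> : (1 - n.+2%:R) * c / 2 = - c + (1 - n%:R) * c / 2.
    by rewrite -[n.+2]addn2 natrD; field.
  rewrite expRD; apply: (@le_trans _ _ (expR (- c) * a n)).
    by apply: ler_wpM2r => //; apply: le_trans (expR_ge1Dx _); lra.
  by apply: ler_wpM2l; [exact: expR_ge0 | apply: IH; lia].
Qed.

(** The losses are bounded through [a n.-1] in [avoidance_b_le], so the decay is needed at [n.-1].
    Replacing 1 by 2 in the exponent absorbs the shift; for [n = 0] the truncated predecessor gives
    [a 0 = 1]. *)
Lemma avoidance_decay_pred J a b c n : avoidance_system P J a b ->
  0 <= c <= \sum_(i in J) P i ^+ 2 ->
  a n.-1 <= expR ((2 - n%:R) * c / 2).
Proof.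
move=> H cS; case: n => [|n] /=; last first.
  apply: le_trans (avoidance_decay n H cS) _.
  by rewrite ler_expR -[n.+1]addn1 natrD; lra.
have [[-> _] _ _ _ _] := H; move: cS => /andP[c0 _].
by apply: le_trans (expR_ge1Dx _); lra.
Qed.

(* First component after [s] steps of the recurrence started at [(d, e)], with
   the transition operator moved from [(d, e)] to [(a, b)]. *)
Definition dual (J : {set K}) (a : nat -> R) (b : K -> nat -> R) (s : nat)
    (d : R) (e : K -> R) : R :=
  d * a s - \sum_(l in J) e l * b l s.

(** The transition operator is self-adjoint for the form [d * a - \sum_l e l * b l]; this is where
    the minus sign in [dual] comes from. *)
Lemma dualS J a b s d e : avoidance_system P J a b ->
  dual J a b s.+1 d e =
  dual J a b s (d - \sum_(l in J) P l * e l) (fun l => P l * (d - e l)).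
Proof.
move=> [_ _ aS bS _]; rewrite /dual aS.
rewrite [X in _ - X = _](eq_bigr
  (fun l => (P l * e l) * a s - P l * (e l * b l s))); last first.
  by move=> l lJ; rewrite bS//; ring.
rewrite [X in _ = _ - X](eq_bigr
  (fun l => d * (P l * b l s) - P l * (e l * b l s))); last first.
  by move=> l lJ; ring.
rewrite !big_split/= !sumrN -mulr_suml -mulr_sumr; ring.
Qed.

Lemma mul_expRN_le2 (t : R) : 0 <= t -> t * expR (- (t / 2)) <= 2.
Proof.
move=> t0; rewrite expRN ler_pdivrMr ?expR_gt0//.
have := expR_ge1Dx (t / 2); lra.
Qed.

(** * Comparison of the product system with the joint system *)

Section pair.
Context (J : {set K}) (i : K) (a A al : nat -> R) (b B be : K -> nat -> R).
Context (iJ : i \notin J).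
Context (Ha : avoidance_system P J a b).
Context (Hal : avoidance_system P [set i] al be).
Context (HA : avoidance_system P (i |: J) A B).

(** The loss in the product [a m * al m] when the word is preceded by [l]: the letter [i] affects
    only the factor [al], a letter of [J] only the factor [a]. *)
Let X m l := if l == i then a m * be i m else b l m * al m.
(** The amount by which [X] fails the joint recurrence for the losses at step [m]. The first
    component fails it by the product of the one-step losses of [a] and [al]. *)
Let defect m l := if l == i then - (P i * (al m - be i m) * \sum_(j in J) P j * b j m)
                      else - (P l * P i * (a m - b l m) * be i m).

Let sumiJ (F : K -> R) : \sum_(l in i |: J) F l = F i + \sum_(l in J) F l.
Proof. by rewrite big_setU1. Qed.

Let ne l : l \in J -> (l == i) = false.
Proof. by move=> lJ; by apply: contraNF iJ => /eqP <-. Qed.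

Let step m s :
  dual (i |: J) A B s (a m.+1 * al m.+1) (X m.+1) -
  dual (i |: J) A B s.+1 (a m * al m) (X m) =
  dual (i |: J) A B s (P i * be i m * \sum_(j in J) P j * b j m) (defect m).
Proof.
rewrite (dualS _ _ _ HA) /dual !sumiJ /X /defect !eqxx.
have [_ _ aS bS _] := Ha; have [_ _ alS beS _] := Hal.
rewrite (eq_bigr (fun l => P l * (a m - b l m) * al m.+1 * B l s)); last first.
  by move=> l lJ; rewrite ne// bS.
rewrite [X in _ - (_ - (_ + X)) = _](eq_bigr
  (fun l => P l * (a m * al m - b l m * al m) * B l s)); last first.
  by move=> l lJ; rewrite ne.
rewrite [X in (_ - (_ + X)) * _](eq_bigr (fun l => P l * b l m * al m)); last first.
  by move=> l lJ; rewrite ne// mulrA.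
rewrite [X in _ = _ - (_ + X)](eq_bigr
  (fun l => P l * (a m - b l m) * al m.+1 * B l s -
            P l * (a m * al m - b l m * al m) * B l s)); last first.
  by move=> l lJ; rewrite ne// alS big_set1; ring.
rewrite big_split/= sumrN -mulr_suml.
set S2 := \sum_(l in J) _ * B l s; set S3 := \sum_(l in J) _ * B l s.
set S1 := \sum_(l in J) _ * _.
have -> : a m.+1 = a m - S1 by exact: aS.
have -> : al m.+1 = al m - P i * be i m by rewrite alS big_set1.
rewrite beS ?set11//.
move: S1 S2 S3 => S1 S2 S3.
ring.
Qed.

(** The hybrid quantity runs the product system for [m] steps and the joint one for [n - m]. It is
    [A n] at [m = 0] and [a n * al n] at [m = n], and [step] gives its increments, so the sum
    telescopes. *)
Let duhamel n :
  a n * al n - A n =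
  \sum_(m < n) dual (i |: J) A B (n - m.+1)%N
     (P i * be i m * \sum_(j in J) P j * b j m) (defect m).
Proof.
transitivity (\sum_(0 <= m < n) (dual (i |: J) A B (n - m.+1)%N (a m.+1 * al m.+1) (X m.+1) -
  dual (i |: J) A B (n - m)%N (a m * al m) (X m))); last first.
  rewrite big_mkord; apply: eq_bigr => -[m mn] _ /=.
  by rewrite -step -subSn.
rewrite (telescope_sumr
  (fun m => dual (i |: J) A B (n - m)%N (a m * al m) (X m)))// subnn subn0.
have [[a_0 b_0] _ _ _ _] := Ha; have [[al_0 be_0] _ _ _ _] := Hal.
have [[A_0 B_0] _ _ _ _] := HA.
rewrite /dual A_0 big1 ?subr0; last by move=> l _; rewrite B_0 mulr0.
rewrite big1 ?subr0; last by move=> l _; rewrite /X be_0 b_0 mulr0 mul0r if_same mul0r.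
by rewrite a_0 al_0 !mul1r mulr1.
Qed.

(** For each [j] there are three terms: from the first component, from the defect at [i] and from
    the defect at [j]. Each carries an explicit [P i * P j] and two loss factors, one for [i] and
    one for [j]; by [avoidance_b_le] these supply a second [P i * P j]. *)
Let errbound m s :
  `|dual (i |: J) A B s (P i * be i m * \sum_(j in J) P j * b j m) (defect m)| <=
  \sum_(j in J) 3 * (P i ^+ 2 * P j ^+ 2 * (al m.-1 * a m.-1 * A s.-1)).
Proof.
have [_ a0 _ _ ab] := Ha; have [_ al0 _ _ alb] := Hal.
have [_ A0 _ _ AB] := HA.
have [be0 beal] := andP (alb i m (set11 i)).
have bele := avoidance_b_le m Hal (set11 i).
have [Pi0 Pi1] := andP (P01 i).
have iJ' : i \in i |: J by rewrite setU11.
have [Bi0 _] := andP (AB i s iJ').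
have Bile := avoidance_b_le s HA iJ'.
have alm := avoidance_le_pred m Hal.
have am := avoidance_le_pred m Ha.
have As := avoidance_le_pred s HA.
have -> : dual (i |: J) A B s (P i * be i m * \sum_(j in J) P j * b j m) (defect m) =
  \sum_(j in J) ((be i m * b j m * A s) * (P i * P j) +
    ((al m - be i m) * b j m * B i s) * (P i * P j) +
    ((a m - b j m) * be i m * B j s) * (P i * P j)).
  rewrite /dual sumiJ /defect eqxx.
  rewrite [X in _ - (_ + X)](eq_bigr
    (fun l => - (((a m - b l m) * be i m * B l s) * (P i * P l)))); last first.
    by move=> l lJ; rewrite ne//; ring.
  rewrite sumrN !big_split/= [in RHS](eq_bigr
    (fun l => (P i * be i m * A s) * (P l * b l m))); last first.
    by move=> l lJ; ring.
  rewrite [X in _ = _ + X + _](eq_bigr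
    (fun l => (P i * (al m - be i m) * B i s) * (P l * b l m))); last first.
    by move=> l lJ; ring.
  by rewrite -!mulr_sumr; ring.
apply: le_trans (ler_norm_sum _ _ _) _; apply: ler_sum => j jJ.
have [Pj0 Pj1] := andP (P01 j).
have [bj0 bja] := andP (ab j m jJ).
have bjle := avoidance_b_le m Ha jJ.
have jJ' : j \in i |: J by rewrite !inE jJ orbT.
have [Bj0 _] := andP (AB j s jJ').
have Bjle := avoidance_b_le s HA jJ'.
have PP := mulr_ge0 Pi0 Pj0.
have mono (x y z x' y' z' : R) : 0 <= x <= x' -> 0 <= y <= y' -> 0 <= z <= z' ->
    0 <= x * y * z <= x' * y' * z'.
  move=> /andP[? ?] /andP[? ?] /andP[? ?].
  by rewrite !mulr_ge0//= !ler_pM// ?mulr_ge0.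
have /andP[l1 h1] : 0 <= be i m * b j m * A s <=
    (P i * al m.-1) * (P j * a m.-1) * A s.-1.
  by apply: mono; apply/andP.
have /andP[l2 h2] : 0 <= (al m - be i m) * b j m * B i s <=
    al m.-1 * (P j * a m.-1) * (P i * A s.-1).
  by apply: mono; apply/andP; split=> //; lra.
have /andP[l3 h3] : 0 <= (a m - b j m) * be i m * B j s <=
    a m.-1 * (P i * al m.-1) * (P j * A s.-1).
  by apply: mono; apply/andP; split=> //; lra.
rewrite ger0_norm; last by rewrite !addr_ge0// mulr_ge0.
rewrite -!mulrDl.
apply: (@le_trans _ _ (3 * (P i * P j * (al m.-1 * a m.-1 * A s.-1)) * (P i * P j))).
  by apply: ler_wpM2r => //; lra.
by rewrite le_eqVlt; apply/orP; left; apply/eqP; ring.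
Qed.

Lemma avoidance_pair n :
  (0 < n)%N ->
  `|A n - a n * al n| <= #|J|%:R * (12 * expR 5) / n%:R.
Proof.
move=> n0; rewrite distrC duhamel.
apply: le_trans (ler_norm_sum _ _ _) _.
(* Each of the [n * #|J|] terms will be at most a constant over [n ^ 2]. *)
apply: (@le_trans _ _ (\sum_(m < n) \sum_(j in J) (12 * expR 5) / n%:R / n%:R)); last first.
  set c := 12 * expR 5; move: c => c.
  rewrite sumr_const card_ord sumr_const.
  have nz : n%:R != 0 :> R by rewrite pnatr_eq0 -lt0n.
  by rewrite mulrnAC -[_ *+ n]mulr_natr divfK// -[_ *+ _]mulr_natl mulrA.
apply: ler_sum => -[m mn] _ /=.
apply: le_trans (errbound _ _) _; apply: ler_sum => j jJ.
set x := P i ^+ 2; set y := P j ^+ 2; set s := (n - m.+1)%N.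
have sq k : 0 <= P k ^+ 2 <= 1.
  by have /andP[? ?] := P01 k; rewrite exprn_ge0//= exprn_ile1.
have [x0 x1] := andP (sq i : 0 <= x <= 1); have [y0 y1] := andP (sq j : 0 <= y <= 1).
have sumJ : y <= \sum_(l in J) P l ^+ 2.
  rewrite (bigD1 j)//= lerDl sumr_ge0// => l _; by have /andP[] := sq l.
have h1 : al m.-1 <= expR ((2 - m%:R) * x / 2).
  by apply: avoidance_decay_pred Hal _; rewrite big_set1 x0 lexx.
have h2 : a m.-1 <= expR ((2 - m%:R) * y / 2).
  by apply: avoidance_decay_pred Ha _; rewrite y0.
have h3 : A s.-1 <= expR ((2 - s%:R) * (x + y) / 2).
  by apply: avoidance_decay_pred HA _; rewrite addr_ge0//= sumiJ lerD2l.
have [_ a0 _ _ _] := Ha; have [_ al0 _ _ _] := Hal; have [_ A0 _ _ _] := HA.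
have ns : n%:R = m%:R + s%:R + 1 :> R by rewrite addrAC natr1 -natrD subnKC.
(* With [m + s = n - 1] the exponents add up to [(5 - n) * (x + y) / 2], and [x + y <= 2] turns the
   surplus into [expR 5]. *)
have h4 : al m.-1 * a m.-1 * A s.-1 <=
    expR 5 * (expR (- (n%:R * x / 2)) * expR (- (n%:R * y / 2))).
  apply: (@le_trans _ _ (expR ((2 - m%:R) * x / 2) * expR ((2 - m%:R) * y / 2) *
     expR ((2 - s%:R) * (x + y) / 2))).
    by rewrite !ler_pM// mulr_ge0.
  by rewrite -!expRD ler_expR ns; lra.
have xy0 : 0 <= x * y by exact: mulr_ge0.
apply: (@le_trans _ _ (3 * (x * y *
  (expR 5 * (expR (- (n%:R * x / 2)) * expR (- (n%:R * y / 2))))))).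
  by do 2!apply: ler_wpM2l => //.
have n0' : 0 < n%:R :> R by rewrite ltr0n.
rewrite ler_pdivlMr// ler_pdivlMr//.
have hx := mul_expRN_le2 (mulr_ge0 (ltW n0') x0).
have hy := mul_expRN_le2 (mulr_ge0 (ltW n0') y0).
(* Each factor [n%:R] is absorbed by one exponential; together with the 3 of [errbound] this makes
   the constant 12. *)
have : (n%:R * x * expR (- (n%:R * x / 2))) * (n%:R * y * expR (- (n%:R * y / 2))) <= 2 * 2.
  by apply: ler_pM => //; apply: mulr_ge0 (expR_ge0 _); apply: mulr_ge0 => //; exact: ltW.
have e5 : 0 <= 3 * expR 5 :> R by rewrite mulr_ge0// expR_ge0.
move=> /(ler_wpM2l e5) h; apply: le_trans (le_trans h _);
  rewrite le_eqVlt; apply/orP; left; apply/eqP; ring.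
Qed.
End pair.
End avoidance_systems.

(** * Weighted words over a finite alphabet *)

Section words.
Context (R : realType) (K : finType) (P : K -> R).

(** [None] stands for all letters outside [K] at once and receives the remaining mass. *)
Definition letter_weight (y : option K) : R :=
  if y is Some i then P i else 1 - \sum_i P i.

Definition word_sum n (f : seq (option K) -> R) : R :=
  \sum_(t : n.-tuple (option K)) (\prod_(y <- t) letter_weight y) * f t.

Lemma sum_option (f : option K -> R) : \sum_y f y = f None + \sum_i f (Some i).
Proof.
rewrite (bigD1 None)//=; congr (_ + _).
rewrite (reindex_omap Some id)/=; first by apply: eq_bigl => i; rewrite eqxx.
by case.
Qed.

Lemma word_sum0 f : word_sum 0 f = f [::].
Proof.
rewrite /word_sum (big_pred1 [tuple]); first by rewrite big_nil mul1r.
by case=> -[]//= i; exact/esym/eqP/val_inj.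
Qed.

Lemma word_sumS n f : word_sum n.+1 f =
  \sum_y letter_weight y * word_sum n (fun s => f (y :: s)).
Proof.
rewrite /word_sum; under [RHS]eq_bigr do rewrite mulr_sumr.
rewrite pair_big/= (reindex
  (fun u : option K * n.-tuple (option K) => [tuple of u.1 :: u.2]))/=.
  by apply: eq_bigr => -[y t] _ /=; rewrite big_cons mulrA.
exists (fun t => (thead t, [tuple of behead t])) => [[y t] _|t _] /=.
  by rewrite theadE; congr (_, _); apply: val_inj.
by rewrite [RHS]tuple_eta.
Qed.

Lemma eq_word_sum n f g : f =1 g -> word_sum n f = word_sum n g.
Proof. by move=> fg; apply: eq_bigr => t _; rewrite fg. Qed.

Lemma word_sumZ n c f : word_sum n (fun s => c * f s) = c * word_sum n f.
Proof. by rewrite /word_sum mulr_sumr; apply: eq_bigr => t _; rewrite mulrCA. Qed.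

Lemma word_sum_sum n (I : finType) (F : I -> seq (option K) -> R) :
  word_sum n (fun s => \sum_i F i s) = \sum_i word_sum n (F i).
Proof.
by rewrite /word_sum exchange_big/=; apply: eq_bigr => t _; rewrite mulr_sumr.
Qed.

Lemma word_sum1 n : word_sum n (fun=> 1) = 1.
Proof.
elim: n => [|n IH]; first by rewrite word_sum0.
rewrite word_sumS; under eq_bigr do rewrite IH mulr1.
by rewrite sum_option/= subrK.
Qed.

Definition avoids (i : K) : rel (option K) :=
  fun x y => ~~ ((x == Some i) && (y == Some i)).

(** The preceding letter [None] forms no forbidden pair, so [survival J None] concerns the word
    alone. One indicator per [i] is the form produced by the expansion over subsets in
    [word_sum_decoupling]. *)
Definition survival (J : {set K}) (x : option K) n : R :=
  word_sum n (fun s => \prod_(i in J) (path (avoids i) x s)%:R).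

Lemma survival0 J x : survival J x 0 = 1.
Proof. by rewrite /survival word_sum0 big1. Qed.

Lemma survivalS J x n : survival J x n.+1 =
  \sum_y letter_weight y * (\prod_(i in J) (avoids i x y)%:R * survival J y n).
Proof.
rewrite /survival word_sumS; apply: eq_bigr => y _; congr (_ * _).
rewrite -word_sumZ; apply: eq_word_sum => s /=.
by rewrite -big_split/=; apply: eq_bigr => i _; rewrite -natrM mulnb.
Qed.

Lemma survivalNS J n : survival J None n.+1 =
  \sum_y letter_weight y * survival J y n.
Proof. by rewrite survivalS; apply: eq_bigr => y _; rewrite big1 ?mul1r. Qed.

Lemma survival_notin (J : {set K}) i n :
  i \notin J -> survival J (Some i) n = survival J None n.
Proof.
move=> iJ; case: n => [|n]; first by rewrite !survival0.
rewrite survivalNS survivalS; apply: eq_bigr => y _.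
rewrite big1 ?mul1r// => j jJ; rewrite /avoids (_ : _ == _ = false)//.
by apply: contraNF iJ => /eqP[->].
Qed.

(** Compared with the predecessor [None], only the next letter [i] becomes forbidden, and its term
    is the one subtracted. *)
Lemma survival_inS (J : {set K}) i n : i \in J ->
  survival J (Some i) n.+1 = survival J None n.+1 - P i * survival J (Some i) n.
Proof.
move=> iJ; rewrite survivalNS survivalS (bigD1 (Some i))//= (bigD1 i)//=.
rewrite {1}/avoids !eqxx/= !mul0r mulr0 add0r.
rewrite [in RHS](bigD1 (Some i))//= [RHS]addrAC subrr add0r.
apply: eq_bigr => y yi; rewrite big1 ?mul1r// => j jJ.
rewrite /avoids; case: eqP => //= -[<-]; by rewrite yi.
Qed.

Context (P0 : forall i, 0 <= P i).
Context (Psum : \sum_i P i <= 1).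

Lemma letter_weight_ge0 y : 0 <= letter_weight y.
Proof. by case: y => [i|] /=; rewrite ?P0// subr_ge0. Qed.

Lemma survival_ge0 J x n : 0 <= survival J x n.
Proof.
by apply: sumr_ge0 => t _; rewrite mulr_ge0//; apply: prodr_ge0 => // y _;
  exact: letter_weight_ge0.
Qed.

Lemma survival_system J : avoidance_system P J (survival J None)
  (fun i n => survival J None n - survival J (Some i) n).
Proof.
split.
- by split=> [|i]; rewrite !survival0// subrr.
- by move=> n; exact: survival_ge0.
- move=> n; rewrite survivalNS sum_option/=.
  rewrite (big_mkcond (fun i => i \in J))/= mulrBl mul1r -addrA; congr (_ + _).
  rewrite mulr_suml -!sumrN -big_split/=; apply: eq_bigr => i _.
  case: ifPn => [_|iJ]; first by ring.
  by rewrite survival_notin//; ring.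
- by move=> i n iJ; rewrite survival_inS//; ring.
- move=> i n iJ; rewrite gerBl survival_ge0 andbT.
  case: n => [|n]; first by rewrite !survival0 subrr.
  by rewrite survival_inS// opprB addrC subrK mulr_ge0// survival_ge0.
Qed.

Let P01 i : 0 <= P i <= 1.
Proof.
rewrite P0/=; apply: le_trans Psum; rewrite (bigD1 i)//= lerDl.
by apply: sumr_ge0 => j _.
Qed.

(** Letters are split off one at a time. Each split costs at most [c] by [avoidance_pair], and the
    error already accumulated is multiplied by a probability [u <= 1], so the costs merely add
    up. *)
Lemma survival_prod n J : (0 < n)%N ->
  `|survival J None n - \prod_(i in J) survival [set i] None n| <=
  #|J|%:R * (#|K|%:R * (12 * expR 5) / n%:R).
Proof.
move=> n0; set c := _ / _.
have [m] := ubnP #|J|; elim: m J => // m IH J Jm.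
have [->|[i iJ]] := set_0Vmem J.
  rewrite big_set0 cards0 mul0r.
  have -> : survival finset.set0 None n = 1.
    rewrite -[RHS](word_sum1 n); apply: eq_word_sum => s; exact: big_set0.
  by rewrite subrr normr0.
have Ji : i \notin J :\ i by rewrite !inE eqxx.
rewrite -(finset.setD1K iJ) big_setU1// cardsU1 Ji.
set J' := J :\ i in Ji *; set s := survival (i |: J') None n.
set u := survival [set i] None n.
have u0 : 0 <= u by exact: survival_ge0.
have u1 : u <= 1 by exact: avoidance_le1 (survival_system [set i]).
have h1 : `|s - survival J' None n * u| <= c.
  apply: le_trans (avoidance_pair P01 Ji (survival_system J') (survival_system [set i])
    (survival_system (i |: J')) n0) _.
  (* [c] has [#|K|] in place of the size of [J'], so that it serves every step of the induction. *)
  rewrite /c ler_pdivrMr ?ltr0n// divfK ?pnatr_eq0 -?lt0n//.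
  by apply: ler_wpM2r; [rewrite mulr_ge0// expR_ge0|rewrite ler_nat max_card].
have h2 := IH J' _.
have -> : s - u * \prod_(j in J') survival [set j] None n =
  (s - survival J' None n * u) +
  u * (survival J' None n - \prod_(j in J') survival [set j] None n).
  by ring.
rewrite natrD mulrDl mul1r; apply: le_trans (ler_normD _ _) _.
apply: lerD => //; rewrite normrM ger0_norm//.
apply: le_trans (ler_piMl (normr_ge0 _) u1) _; apply: h2.
by move: Jm; rewrite [#|J|](cardsD1 i) iJ.
Qed.

Lemma word_sum_decoupling n (x : K -> bool) : (0 < n)%N ->
  `|word_sum n (fun s => \prod_i (path (avoids i) None s == ~~ x i)%:R) -
    \prod_i word_sum n (fun s => (path (avoids i) None s == ~~ x i)%:R)| <=
  (2 ^ #|K|)%:R * (#|K|%:R * (#|K|%:R * (12 * expR 5))) / n%:R.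
Proof.
move=> n0.
(* The indicator of avoidance is kept if [x i] is false and becomes 1 minus itself if [x i] is true;
   both cases are affine in it, with slope [e i] and constant [c i]. *)
pose c i : R := (x i)%:R; pose e i : R := (-1) ^+ x i.
have ind i s : (path (avoids i) None s == ~~ x i)%:R =
    e i * (path (avoids i) None s)%:R + c i.
  by rewrite /e /c; case: (path _ _ _) (x i) => -[] /=; rewrite ?expr1 ?expr0; ring.
pose q (J : {set K}) : R := \prod_(i in J) e i * \prod_(i in ~: J) c i.
have expand (f : K -> R) : \prod_i (e i * f i + c i) =
    \sum_(J : {set K}) q J * \prod_(i in J) f i.
  rewrite bigA_distr; apply: eq_bigr => J _.
  rewrite (bigID (fun i => i \in J))/=.
  under eq_bigr => i iJ do rewrite iJ.
  under [X in _ * X = _]eq_bigr => i iJ do rewrite (negbTE iJ).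
  rewrite big_split/= mulrAC; congr (_ * _ * _).
  by apply: eq_bigl => i; rewrite inE.
have -> : word_sum n (fun s => \prod_i (path (avoids i) None s == ~~ x i)%:R) =
    \sum_(J : {set K}) q J * survival J None n.
  under [RHS]eq_bigr do rewrite -word_sumZ.
  rewrite -word_sum_sum; apply: eq_word_sum => s.
  by rewrite -expand; apply: eq_bigr => i _; rewrite ind.
have -> : \prod_i word_sum n (fun s => (path (avoids i) None s == ~~ x i)%:R) =
    \sum_(J : {set K}) q J * \prod_(i in J) survival [set i] None n.
  rewrite -expand; apply: eq_bigr => i _.
  have -> : c i = word_sum n (fun=> c i * 1) by rewrite word_sumZ word_sum1 mulr1.
  rewrite /survival -word_sumZ /word_sum -big_split/=.
  by apply: eq_bigr => t _; rewrite -mulrDr big_set1 mulr1 ind.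
rewrite -sumrB; apply: le_trans (ler_norm_sum _ _ _) _.
(* One error of [survival_prod] for each subset, with coefficient at most 1 in absolute value. *)
have -> : (2 ^ #|K|)%N = #|{set K}|.
  by rewrite -cardsT -[in RHS]cardsT -powersetT card_powerset.
rewrite -mulrA mulr_natl -sumr_const.
apply: ler_sum => J _; rewrite -mulrBr normrM.
have q1 : `|q J| <= 1.
  rewrite normrM !normr_prod mulr_ile1 ?prodr_ge0//.
    by rewrite big1// => i _; rewrite /e normrX normrN1 expr1n.
  rewrite prodr_ile1// => i _; rewrite normr_ge0/= /c normr_nat.
  by case: (x i).
apply: le_trans (ler_piMl (normr_ge0 _) q1) _.
apply: le_trans (survival_prod J n0) _.
rewrite -[leRHS]mulrA; apply: ler_wpM2r; last by rewrite ler_nat max_card.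
by rewrite divr_ge0// !mulr_ge0// expR_ge0.
Qed.
End words.

(** * From geometric variables to weighted words *)

Lemma prob_finite_sum (d : measure_display) (T : measurableType d) (R : realType)
    (P : probability T R) (F : finType) (Y : T -> F) (E : pred F) :
  (forall y, measurable (Y @^-1` [set y])) ->
  prob P [set w | E (Y w)] = \sum_(y | E y) prob P (Y @^-1` [set y]).
Proof.
move=> mY; rewrite /prob.
have -> : [set w | E (Y w)] = \bigcup_(y in [set` enum E]) (Y @^-1` [set y]).
  apply/seteqP; split=> [w /= Ew|w /= [y /=]].
    by exists (Y w) => //=; rewrite mem_enum.
  by rewrite mem_enum => Ey Yw; rewrite Yw.
rewrite measure_fin_bigcup//; last exact: trivIset_preimage1.
rewrite -fsbig_seq ?enum_uniq// big_enum/= sum_fine// => y _.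
exact: fin_num_measure.
Qed.

Lemma prob_ge0 (d : measure_display) (T : measurableType d) (R : realType)
  (P : probability T R) (A : set T) : 0 <= prob P A.
Proof. by rewrite fine_ge0. Qed.

Section link.
Context (R : realType) (p : R) (n : nat) (d : measure_display)
  (T : measurableType d) (P : probability T R) (Z : 'I_n -> {RV P >-> nat})
  (I : {fset nat}).
Context (iidZ : iid_geometric p Z).
Context (I_ge1 : forall i, i \in I -> (1 <= i)%N).

(* Letters outside [I] are identified, which makes the alphabet finite. *)
Definition letter (z : nat) : option I := insub z.

Lemma letter_eq z i : (letter z == Some i) = (z == val i).
Proof.
rewrite /letter; case: insubP => [j _ <-|zI]; first by rewrite (inj_eq Some_inj).
by apply/esym/negbTE; apply: contraNneq zI => ->; exact: valP.
Qed.

Definition word (w : T) : n.-tuple (option I) := [tuple letter (Z k w) | k < n].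

Definition geometric_weight (i : I) : R := p * (1 - p) ^+ (val i).-1.

Lemma measurable_letter k y : measurable (Z k @^-1` (letter @^-1` [set y])).
Proof. by rewrite -[X in measurable X]setTI; exact: measurable_funP. Qed.

Lemma prob_letter_Some k i :
  prob P (Z k @^-1` (letter @^-1` [set Some i])) = geometric_weight i.
Proof.
rewrite /geometric_weight -(iidZ.2 k)//; last by apply: I_ge1; exact: valP.
congr (prob P _); apply/seteqP; split => w /= /eqP.
  by rewrite letter_eq => /eqP.
by rewrite -letter_eq => /eqP.
Qed.

Lemma prob_letter_None k :
  prob P (Z k @^-1` (letter @^-1` [set None])) = 1 - \sum_i geometric_weight i.
Proof.
have := prob_finite_sum P xpredT (measurable_letter k).
have -> : [set w | xpredT ((letter \o Z k) w)] = setT by exact/seteqP.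
rewrite {1}/prob probability_setT [fine 1]/= sum_option => ->.
under [X in _ - X]eq_bigr do rewrite -(prob_letter_Some k).
by rewrite addrK.
Qed.

Lemma prob_letter k y :
  prob P (Z k @^-1` (letter @^-1` [set y])) = letter_weight geometric_weight y.
Proof. by case: y => [i|]; [exact: prob_letter_Some|exact: prob_letter_None]. Qed.

Lemma word_fiber t : word @^-1` [set t] =
  [set w | forall k, k \in [set: 'I_n]%SET -> (letter @^-1` [set tnth t k]) (Z k w)].
Proof.
apply/seteqP; split=> w /= => [<- k _|H]; first by rewrite tnth_mktuple.
by apply: eq_from_tnth => k; rewrite tnth_mktuple; apply: H; rewrite inE.
Qed.

Lemma measurable_word t : measurable (word @^-1` [set t]).
Proof.
rewrite word_fiber.
rewrite (_ : mkset _ = \bigcap_(k in [set: 'I_n]) (Z k @^-1` (letter @^-1` [set tnth t k]))).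
  by apply: fin_bigcap_measurable => // k _; exact: measurable_letter.
by apply/seteqP; split=> w H k _; apply: H; rewrite ?inE.
Qed.

(** The event splits into the fibres of [word]; each fibre is an intersection of letter events over
    all positions, to which independence applies. *)
Lemma prob_word (E : pred (seq (option I))) :
  prob P [set w | E (word w)] = word_sum geometric_weight n (fun s => (E s)%:R).
Proof.
rewrite (prob_finite_sum P (fun t : n.-tuple (option I) => E t) measurable_word) /word_sum.
rewrite big_mkcond; apply: eq_bigr => t _.
case: ifP => _; last by rewrite mulr0.
rewrite mulr1 word_fiber (iidZ.1 [set: 'I_n]%SET
  (fun k => letter @^-1` [set tnth t k]))// big_tuple.
by apply: eq_big => k; [rewrite inE|rewrite prob_letter].
Qed.

(** In the path from [None], position 0 imposes nothing and position [j.+1] compares the letters [j]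
    and [j.+1] of the word. The indicator is thus the negation of avoidance. *)
Lemma pair_indicatorE (i : I) (b : bool) w :
  (pair_indicator Z (val i) w = b%:R :> R) <->
  path (avoids i) None (word w) == ~~ b.
Proof.
have nthw (k : 'I_n) : nth None (word w) k = letter (Z k w) by rewrite nth_mktuple.
have -> : pair_indicator Z (val i) w = (~~ path (avoids i) None (word w))%:R :> R.
  rewrite /pair_indicator indicE; congr (_%:R); congr nat_of_bool.
  apply/idP/idP => [/[!inE] -[k [l [lk Zk Zl]]]|].
    apply/negP => /(pathP None)/(_ l); rewrite size_tuple ltn_ord => /(_ isT).
    by rewrite nthw {1}lk/= nthw /avoids !letter_eq Zk Zl !eqxx.
  apply: contraNT; rewrite notin_setE => no; apply/(pathP None) => j.
  rewrite size_tuple => jn; apply/negP => /andP[].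
  case: j jn => // j jn /=.
  rewrite (nthw (Ordinal (ltnW jn))) (nthw (Ordinal jn)) !letter_eq => /eqP Zk /eqP Zl.
  by apply: no; exists (Ordinal (ltnW jn)), (Ordinal jn).
by case: b (path _ _ _) => -[] /=; split=> // /eqP; rewrite ?oner_eq0// eq_sym oner_eq0.
Qed.
End link.

Theorem theorem2p2 (R : realType) (p : R) (hp : 0 < p < 1) (k : nat) :
  exists C : R, \forall n \near \oo,
    forall (d : measure_display) (T : measurableType d) (P : probability T R)
      (Z : 'I_n -> {RV P >-> nat}),
    iid_geometric p Z ->
    forall I : {fset nat},
      (forall i, i \in I -> (1 <= i)%N) -> #|` I|%fset = k ->
    forall x : {ffun I -> bool},
      `| prob P [set w | forall i : I, pair_indicator Z (val i) w = (x i)%:R :> R]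
         - \prod_(i : I) prob P [set w | pair_indicator Z (val i) w = (x i)%:R :> R] |
      <= C / n%:R.
Proof.
(* The constant of [word_sum_decoupling] for an alphabet of [k] letters; the letters themselves do
   not enter it. *)
exists ((2 ^ k)%:R * (k%:R * (k%:R * (12 * expR 5)))).
exists 1%N => // n /= n0 d T P Z iidZ I I1 Ik x.
have [p0 p1] := andP hp.
have w0 i : 0 <= geometric_weight p (I := I) i.
  by rewrite mulr_ge0 ?exprn_ge0 ?subr_ge0 // ltW.
have w1 : \sum_(i : I) geometric_weight p i <= 1.
  (* As [n > 0] there is a first letter, and the remaining mass is the probability that it lies
     outside [I]. *)
  by rewrite -subr_ge0 -(prob_letter_None iidZ I1 (Ordinal n0)) prob_ge0.
rewrite -Ik cardfE; apply: le_trans (word_sum_decoupling w0 w1 x n0).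
have -> : prob P [set w | forall i : I, pair_indicator Z (val i) w = (x i)%:R :> R] =
    word_sum (geometric_weight p (I := I)) n
      (fun s => \prod_i (path (avoids i) None s == ~~ x i)%:R).
  pose E s := [forall i : I, path (avoids i) None s == ~~ x i].
  transitivity (prob P [set w | E (word Z I w)]).
    congr (prob P _); apply/seteqP; split=> w /=.
      by move=> H; apply/forallP => i; apply/(pair_indicatorE Z); exact: H.
    by move=> /forallP H i; apply/(pair_indicatorE Z); exact: H.
  rewrite (prob_word iidZ I1); apply: eq_word_sum => s.
  have [/forallP Es|/forallPn[i /negbTE nEs]] := boolP (E s).
    by rewrite big1// => i _; rewrite Es.
  by rewrite (bigD1 i)//= nEs mul0r.
rewrite (eq_bigr (fun i => word_sum (geometric_weight p (I := I)) n
  (fun s => (path (avoids i) None s == ~~ x i)%:R))) // => i _.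
rewrite -(prob_word iidZ I1 (fun s => path (avoids i) None s == ~~ x i)).
by congr (prob P _); apply/seteqP; split=> w /= /(pair_indicatorE Z).
Qed.
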